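(* Let $A\in H_\alpha$. Then there exist a strictly positive Hölder continuous function $\psi_A:\mathcal B\to\mathbb R$ and a real number $\lambda_A>0$ such that $\mathcal L_A(\psi_A)=\lambda_A\psi_A$, where $\mathcal L_A:\mathcal C\to\mathcal C$. The eigenvalue $\lambda_A$ is simple, meaning that the associated eigenfunction is unique up to multiplication by a constant.
   Context: $(M,d_M)$ is a compact metric space, $\mathcal B=M^{\mathbb N}$ (with $\mathbb N=\{1,2,\dots\}$) has the metric $d(x,y)=\sum_{n\ge1}2^{-n}d_M(x_n,y_n)$, and $\mathcal C$ is the space of continuous functions $\mathcal B\to\mathbb R$. Fix $\alpha\in(0,1]$; $H_\alpha$ is the set of $\alpha$-Hölder continuous functions $\mathcal B\to\mathbb R$ with respect to $d$. Fix a Borel probability measure $\nu$ on $M$ whose support is all of $M$ (the a-priori probability). For $a\in M$, $x\in\mathcal B$, $ax=(a,x_1,x_2,\dots)$. For $A\in H_\alpha$ the transfer (Ruelle) operator is $\mathcal L_A(\varphi)(x)=\int_M e^{A(ax)}\varphi(ax)\,d\nu(a)$, $\varphi\in\mathcal C$. *)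

(* Defs.v *)
From HB Require Import structures.
From mathcomp Require Import all_boot all_order all_algebra.
From mathcomp Require Import all_classical all_reals all_analysis.
Set Implicit Arguments.
Unset Strict Implicit.
Unset Printing Implicit Defensive.
Import Order.TTheory GRing.Theory Num.Theory.
Import numFieldNormedType.Exports.
Local Open Scope classical_set_scope.
Local Open Scope ring_scope.

HB.mixin Record Metric_isCompact (K : numDomainType) M & Metric K M := {
  compact_setT : compact [set: M]
}.

(* The base point is needed by [measurableType]; mathematically it only says
   that the space is nonempty, which the existence of a probability on it
   forces anyway. *)
#[short(type="compactMetricType")]
HB.structure Definition CompactMetric (K : numDomainType) :=
  { M of Metric K M & isPointed M & Metric_isCompact K M }.

(* M^N with N = {1, 2, ...}: the coordinate x_n is [x n.-1]. *)
Definition config (M : Type) : Type := nat -> M.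

HB.instance Definition _ (M : Type) := gen_eqMixin (config M).
HB.instance Definition _ (M : Type) := gen_choiceMixin (config M).

Definition config_cons (M : Type) (a : M) (x : config M) : config M :=
  fun n => if n is k.+1 then x k else a.

Definition config_dist (R : realType) (M : metricType R) (x y : config M) : R :=
  limn (series (fun n => 2^-1 ^+ n.+1 * mdist (x n) (y n))).

Section config_metric.
Context (R : realType) (M : compactMetricType R).
Implicit Types x y z : config M.

Let term x y n : R := 2^-1 ^+ n.+1 * mdist (x n) (y n).

Let term_ge0 x y n : 0 <= term x y n.
Proof. by rewrite mulr_ge0 ?mdist_ge0// exprn_ge0// invr_ge0. Qed.

Lemma mdist_bounded : exists K : R, forall a b : M, mdist a b <= K.
Proof.
pose f := fun b : M => mdist (point : M) b : R.
have fc : continuous f.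
  move=> b; apply/cvgrPdist_lt => e e0.
  near=> c.
  have bc : mdist b c < e.
    have : ball b e c by near: c; exact: nbhsx_ballx.
    by rewrite ballEmdist.
  have := metric_triangle (point : M) b c.
  have := metric_triangle (point : M) c b.
  rewrite (metric_sym c b) /f => h1 h2.
  rewrite ltr_norml; apply/andP; split.
    by rewrite ltrBrDr addrC ltrBlDr (le_lt_trans h2)// ltrD2l.
  by rewrite ltrBlDr addrC (le_lt_trans h1)// ltrD2l.
have : compact (f @` [set: M]).
  apply: continuous_compact; last exact: compact_setT.
  exact: continuous_subspaceT.
move=> /compact_bounded[N [_ NB]].
exists ((N + 1) + (N + 1)) => a b.
have fb c : f c <= N + 1.
  by rewrite (le_trans (ler_norm _))// (NB (N + 1)) ?ltrDl//; exists c.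
by rewrite (le_trans (metric_triangle a point b))// lerD// metric_sym.
Unshelve. all: by end_near. Qed.

Lemma config_dist_is_cvg x y : cvgn (series (term x y)).
Proof.
have [K Kb] := mdist_bounded.
have K0 : 0 <= K by rewrite (le_trans _ (Kb point point)) ?mdist_ge0.
apply: (@series_le_cvg _ _ (geometric K 2^-1)) => [n|n|n|].
- exact: term_ge0.
- by rewrite /= mulr_ge0// exprn_ge0// invr_ge0.
- rewrite /geometric/= mulrC ler_pM ?mdist_ge0 ?exprn_ge0 ?invr_ge0//.
  by rewrite exprS ler_piMl ?exprn_ge0 ?invr_ge0// invf_le1// ler1n.
- apply: is_cvg_geometric_series.
  by rewrite ger0_norm ?invr_ge0// invf_lt1// ltr1n.
Qed.

Let config_distxx x : config_dist x x = 0.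
Proof.
rewrite /config_dist (_ : series _ = cst 0) ?lim_cst//.
by apply/funext => n; rewrite /series/= big1// => i _; rewrite mdistxx mulr0.
Qed.

Let config_dist_term x y n : term x y n <= config_dist x y.
Proof.
apply: (@le_trans _ _ (series (term x y) n.+1)).
  rewrite /series/= big_nat_recr//= lerDr.
  by apply: sumr_ge0 => i _; exact: term_ge0.
apply: nondecreasing_cvgn_le; last exact: config_dist_is_cvg.
apply/nondecreasing_seqP => k.
by rewrite /series/= big_nat_recr//= lerDl term_ge0.
Qed.

Let config_dist_positivity x y : config_dist x y = 0 -> x = y.
Proof.
move=> xy0; apply/funext => n; apply: (@mdist_positivity R M).
have := config_dist_term x y n; rewrite xy0 => t0.
have /eqP : term x y n = 0 by apply/eqP; rewrite eq_le t0 term_ge0.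
by rewrite mulf_eq0 expf_eq0 invr_eq0 pnatr_eq0/= => /eqP.
Qed.

Let config_dist_sym x y : config_dist x y = config_dist y x.
Proof.
rewrite /config_dist; congr (limn (series _)); apply/funext => n.
by rewrite metric_sym.
Qed.

Let config_dist_triangle y x z :
  config_dist x z <= config_dist x y + config_dist y z.
Proof.
rewrite /config_dist -limD; [|exact: config_dist_is_cvg..].
apply: ler_lim; first exact: config_dist_is_cvg.
  by apply: is_cvgD; exact: config_dist_is_cvg.
apply: nearW => n; rewrite [leRHS]/GRing.add/= /series/= -big_split/=; apply: ler_sum => i _.
by rewrite -mulrDr ler_wpM2l ?metric_triangle// exprn_ge0// invr_ge0.
Qed.

HB.instance Definition _ := isMetric.Build R (config M)
  config_distxx config_dist_positivity config_dist_sym config_dist_triangle.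

Lemma config_mdistE x y : mdist x y = config_dist x y.
Proof. by []. Qed.

End config_metric.

Definition hoelder_space (R : realType) (X : metricType R) (alpha : R) :
    set (X -> R) :=
  [set f | exists C : R, forall x y, `|f x - f y| <= C * mdist x y `^ alpha].

Definition borel (R : realType) (M : compactMetricType R) :=
  g_sigma_algebraType (@open M).

Definition measure_support (R : realType) (M : compactMetricType R)
    (nu : {measure set (borel M) -> \bar R}) : set M :=
  [set a | forall U : set M, open U -> U a -> (0 < nu U)%E].

Definition ruelle (R : realType) (M : compactMetricType R)
    (nu : probability (borel M) R) (A phi : config M -> R) : config M -> R :=
  fun x => \int[nu]_a (expR (A (config_cons a x)) * phi (config_cons a x)).

(* Main.v *)
Require Import Defs.
From mathcomp Require Import all_boot all_order all_algebra ring lra.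
From mathcomp Require Import all_classical all_reals all_analysis.
From mathcomp Require Import measurable_realfun.
Set Implicit Arguments.
Unset Strict Implicit.
Unset Printing Implicit Defensive.
Import Order.TTheory GRing.Theory Num.Theory.
Import numFieldNormedType.Exports.
Local Open Scope classical_set_scope.
Local Open Scope ring_scope.

(** Existence comes from a Birkhoff-type contraction of cones, and simplicity
from a maximum principle.

For D >= 0 let K_D be the cone of nonnegative functions h with
h x <= exp(D d(x,y)^alpha) h y. Since d(ax, ay) = d(x,y)/2 and A is
alpha-Hoelder with some constant C, the operator L sends K_D into K_D' with
D' = 2^-alpha (C + D) ([ruelle_cone]), and D' < D once D = C / (1 - 2^-alpha).
The space has finite diameter, so two elements h, k of the smaller cone are
uniformly comparable: h - t k stays in K_D as soon as t is at most a fixed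
fraction c of h x0 / k x0 ([log_hoelder_cone_sub]). Consequently, if
L g - a g and b g - L g both lie in K_D, then applying L and taking off from
each difference the multiple of L g that the comparison allows gives the same
statement for L g, with the interval [a, b] shortened by the factor 1 - c
([iterates_comparable]). Starting with g = 1, the ratios of consecutive
iterates L^n 1 become constant at a geometric rate, so the normalised iterates
L^n 1 / (L^n 1)(x0) converge uniformly to an element psi of K_D', which is
positive, Hoelder, and an eigenfunction ([positive_operator_eigenfunction]).

For simplicity, let phi be a continuous eigenfunction for the same eigenvalue.
The space is compact, so phi / psi attains a maximum c, and
h = c psi - phi is a nonnegative eigenfunction with a zero. As nu has
full support, L h x = 0 forces h (ax) = 0 for every a ([ruelle_eq0]): the zero
set of h is stable under adding a letter in front. The points reached in this
way are dense, so h = 0 ([cons_closed_zeros]). *)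

(** * Continuity in metric spaces *)

Lemma nbhs_mdistP (R : realType) (X : metricType R) (x : X) (P : set X) :
  (exists2 e : R, 0 < e & forall y, mdist x y < e -> P y) <->
  (\forall y \near x, P y).
Proof.
split=> [[e e0 eP]|/nbhs_ballP[e /= e0 eP]].
  by apply/nbhs_ballP; exists e => // y; rewrite ballEmdist; exact: eP.
by exists e => // y xy; apply: eP; rewrite ballEmdist.
Qed.

Lemma continuous_mdistP (R : realType) (X : metricType R) (f : X -> R) :
  continuous f <-> forall x e, 0 < e ->
    exists2 d : R, 0 < d & forall y, mdist x y < d -> `|f x - f y| <= e.
Proof.
split=> [fc x e e0|fd x].
  by apply/nbhs_mdistP; move/cvgrPdist_le : (fc x); exact.
by apply/cvgrPdist_le => e e0; apply/nbhs_mdistP; exact: fd.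
Qed.

Lemma hoelder_continuous (R : realType) (X : metricType R) (alpha : R)
    (f : X -> R) : 0 < alpha -> hoelder_space alpha f -> continuous f.
Proof.
move=> a0 [C fC]; apply/continuous_mdistP => x e e0.
pose b := e / (`|C| + 1).
have C1 : 0 < `|C| + 1 by rewrite ltr_wpDl.
have b0 : 0 < b by rewrite divr_gt0.
exists (b `^ alpha^-1); first by rewrite powR_gt0.
move=> y xy; apply: le_trans (fC x y) _; rewrite ltW//.
have xyb : mdist x y `^ alpha < b.
  have := gt0_ltr_powR a0 (mdist_ge0 x y) (powR_ge0 _ _) xy.
  by rewrite -powRrM mulVf ?gt_eqF// powRr1// ltW.
apply: (@le_lt_trans _ _ (`|C| * b)).
  rewrite (le_trans (ler_wpM2r (powR_ge0 _ _) (ler_norm C)))//.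
  by rewrite ler_wpM2l// ltW.
by rewrite /b mulrCA gtr_pMr// ltr_pdivrMr// mul1r ltrDl.
Qed.

(** * Two inequalities for the exponential *)

Lemma expR_sub1_le (R : realType) (u : R) : expR u - 1 <= u * expR u.
Proof.
have := expR_ge1Dx (- u); rewrite expRN -(ler_pM2r (expR_gt0 u)).
by rewrite mulVf ?expR_eq0// mulrDl mul1r mulNr; lra.
Qed.

(** Convexity of exp along the segment from - u to 0, as the p-weighted mean of
the tangent inequality at the intermediate point - p u. *)
Lemma expRN_convex (R : realType) (p u : R) : 0 <= p <= 1 ->
  expR (- (p * u)) <= p * expR (- u) + (1 - p).
Proof.
case/andP=> p0 p1; set E := expR (- (p * u)).
have E0 : 0 < E by exact: expR_gt0.
have h1 : E * (1 - (1 - p) * u) <= expR (- u).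
  have -> : - u = - (p * u) + - ((1 - p) * u) by ring.
  by rewrite expRD ler_pM2l// expR_ge1Dx.
have h2 : E * (1 + p * u) <= 1.
  rewrite [leRHS](_ : _ = E * expR (p * u)); last by rewrite -expRD addNr expR0.
  by rewrite ler_pM2l// expR_ge1Dx.
have h3 := ler_wpM2l p0 h1.
have h4 : (1 - p) * (E * (1 + p * u)) <= (1 - p) * 1.
  by rewrite ler_wpM2l// subr_ge0.
apply: le_trans (lerD h3 (le_trans h4 _)); last by rewrite mulr1.
by rewrite le_eqVlt; apply/orP; left; apply/eqP; ring.
Qed.

(** * The cone of log-Hoelder functions *)

Section cone.
Context (R : realType) (X : metricType R) (alpha : R).
Implicit Types (h k : X -> R) (D : R).

(** The bound is kept multiplicative, instead of requiring log h to be Hoelder,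
so that the zero function and limits of positive functions belong to the
cone. *)
Definition log_hoelder_cone D : set (X -> R) :=
  [set h | (forall x, 0 <= h x) /\
    forall x y, h x <= expR (D * mdist x y `^ alpha) * h y].

Lemma log_hoelder_coneS D D' : D' <= D ->
  log_hoelder_cone D' `<=` log_hoelder_cone D.
Proof.
move=> DD h [h0 hD]; split=> // x y; apply: le_trans (hD x y) _.
by rewrite ler_wpM2r// ler_expR ler_wpM2r// powR_ge0.
Qed.

Lemma log_hoelder_coneZ D h t : 0 <= t -> log_hoelder_cone D h ->
  log_hoelder_cone D (fun x => t * h x).
Proof.
move=> t0 [h0 hD]; split=> [x|x y]; first by rewrite mulr_ge0.
by rewrite mulrCA ler_wpM2l.
Qed.

Lemma log_hoelder_cone1 D : 0 <= D -> log_hoelder_cone D (cst 1).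
Proof.
move=> D0; split=> // x y; rewrite /cst/= mulr1 -[leLHS]expR0 ler_expR.
by rewrite mulr_ge0// powR_ge0.
Qed.

Context (Delta : R) (diamX : forall x y : X, mdist x y `^ alpha <= Delta).

(** A Harnack inequality: in finite diameter the values of an element of the cone
are comparable to each other, with a constant independent of the element. *)
Lemma log_hoelder_cone_harnack D h x y : 0 <= D -> log_hoelder_cone D h ->
  h x <= expR (D * Delta) * h y.
Proof.
move=> D0 [h0 hD]; apply: le_trans (hD x y) _.
by rewrite ler_wpM2r// ler_expR ler_wpM2l.
Qed.

Lemma log_hoelder_cone_hoelder D h : 0 <= D -> log_hoelder_cone D h ->
  hoelder_space alpha h.
Proof.
move=> D0 hh; have [h0 hD] := hh.
have [[x0 _]|X0] := pselect (exists x0 : X, True); last first.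
  by exists 0 => x; exfalso; apply: X0; exists x.
pose B := D * expR (D * Delta) * (expR (D * Delta) * h x0).
have main x y : h x - h y <= B * mdist x y `^ alpha.
  set g := mdist x y `^ alpha.
  have g0 : 0 <= g by exact: powR_ge0.
  have hb : h y <= expR (D * Delta) * h x0 by exact: log_hoelder_cone_harnack.
  apply: (@le_trans _ _ ((expR (D * g) - 1) * h y)).
    by rewrite mulrBl mul1r lerD2r; exact: hD.
  apply: (@le_trans _ _ ((D * g * expR (D * Delta)) * (expR (D * Delta) * h x0))).
    apply: ler_pM => //.
      by rewrite subr_ge0 -[leLHS]expR0 ler_expR mulr_ge0.
    apply: le_trans (expR_sub1_le _) _.
    by rewrite ler_wpM2l ?mulr_ge0// ler_expR ler_wpM2l//; exact: diamX.
  by rewrite /B le_eqVlt; apply/orP; left; apply/eqP; ring.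
exists B => x y; rewrite ler_norml main andbT lerNl opprB.
by rewrite metric_sym main.
Qed.

Lemma log_hoelder_cone_continuous D h : 0 < alpha -> 0 <= D ->
  log_hoelder_cone D h -> continuous h.
Proof.
by move=> a0 D0 hh; exact: hoelder_continuous a0 (log_hoelder_cone_hoelder D0 hh).
Qed.

(** The smaller cone sits well inside the larger one. At a pair of points with
g = d(x,y)^alpha, the difference h - t k satisfies the inequality of K_D if
t k y (exp(D g) - exp(- D' g)) <= h y (exp(D g) - exp(D' g)). The quotient of
the two exponential differences tends to (D - D') / (D + D') as g tends to 0
and, by convexity, never falls below it: that is where D' < D is used. Harnack
then transfers the condition on t from y to the base point, at the cost of
exp(2 D' Delta). *)
Lemma log_hoelder_cone_sub D D' : 0 <= D' -> D' < D ->
  exists2 c : R, 0 < c <= 1 & forall h k (x0 : X) t,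
    log_hoelder_cone D' h -> log_hoelder_cone D' k ->
    0 <= t -> t * k x0 <= c * h x0 ->
    log_hoelder_cone D (fun x => h x - t * k x).
Proof.
move=> D'0 D'D; have D0 : 0 < D by exact: le_lt_trans D'D.
have DD0 : 0 < D + D' by rewrite ltr_wpDr.
pose p := (D - D') / (D + D'); pose E := expR (D' * Delta).
have p0 : 0 < p by rewrite divr_gt0// subr_gt0.
have p1 : p <= 1 by rewrite ler_pdivrMr// mul1r lerD2l; lra.
have E0 : 0 < E by exact: expR_gt0.
have [|E1] := ltP E 1.
  (* Delta < 0 leaves no room for the base point x0. *)
  move=> E1; exists 1; first by rewrite ltr01 lexx.
  move=> h k x0 t _ _ _ _; exfalso; move: E1; rewrite ltNge => /negP; apply.
  rewrite -[leLHS]expR0 ler_expR mulr_ge0//.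
  by apply: le_trans (diamX x0 x0); exact: powR_ge0.
exists (p / E ^+ 2).
  rewrite divr_gt0 ?exprn_gt0//= ler_pdivrMr ?exprn_gt0// mul1r.
  by rewrite (le_trans p1)// exprn_ege1.
move=> h k x0 t hh kk t0 tc.
have [[h0 hD] [k0 kD]] := (hh, kk).
have key y : t * k y <= p * h y.
  have k1 : k y <= E * k x0 by exact: log_hoelder_cone_harnack.
  have h1 : h x0 <= E * h y by exact: log_hoelder_cone_harnack.
  apply: le_trans (ler_wpM2l t0 k1) _; rewrite mulrCA.
  apply: le_trans (ler_wpM2l (ltW E0) tc) _.
  apply: (@le_trans _ _ (E * (p / E ^+ 2 * (E * h y)))).
    rewrite ler_wpM2l ?(ltW E0)// ler_wpM2l// divr_ge0 ?exprn_ge0//; exact: ltW.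
  rewrite le_eqVlt; apply/orP; left; apply/eqP.
  by field; rewrite gt_eqF.
split=> [x|x y].
  by rewrite subr_ge0 (le_trans (key x))// ler_piMl.
set g := mdist x y `^ alpha.
have g0 : 0 <= g by exact: powR_ge0.
have hx : h x <= expR (D' * g) * h y by exact: hD.
(* The bound of k from below is its cone inequality with x and y exchanged. *)
have kx : expR (- (D' * g)) * k y <= k x.
  rewrite expRN -(ler_pM2l (expR_gt0 (D' * g))) mulrA mulfV ?expR_eq0// mul1r.
  by rewrite /g metric_sym; exact: kD.
(* Convexity with u = (D + D') g, multiplied by exp(D g); p u = (D - D') g. *)
have cvx : expR (D' * g) <= p * expR (- (D' * g)) + (1 - p) * expR (D * g).
  have /(expRN_convex ((D + D') * g)) : 0 <= p <= 1 by rewrite ltW.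
  rewrite -(ler_pM2l (expR_gt0 (D * g))) mulrDr (mulrCA _ p (expR _)) -!expRD.
  rewrite (_ : D * g + - (p * ((D + D') * g)) = D' * g); last first.
    by rewrite /p; field; rewrite gt_eqF.
  rewrite (_ : D * g + - ((D + D') * g) = - (D' * g)); last by ring.
  by rewrite (mulrC _ (1 - p)).
have tkx := ler_wpM2l t0 kx.
have EE : 0 <= expR (D * g) - expR (- (D' * g)).
  by rewrite subr_ge0 ler_expR; nra.
have := ler_wpM2l EE (key y).
have := ler_wpM2r (h0 y) cvx.
by move: tkx hx; lra.
Qed.

End cone.

(** * Geometric convergence *)

Lemma le_geometric (R : realType) (theta C x y : R) : 0 <= theta < 1 ->
  (forall n, x <= y + C * theta ^+ n) -> x <= y.
Proof.
case/andP=> t0 t1 H; have cv : y + C * theta ^+ n @[n --> \oo] --> y + C * 0.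
  apply: cvgD; first exact: cvg_cst.
  by apply: cvgMr; apply: cvg_expr; rewrite ger0_norm.
rewrite -[leRHS]addr0 -(mulr0 C) -(cvg_lim _ cv)//.
apply: limr_ge; first by apply/cvg_ex; eexists; exact: cv.
by apply: nearW => n; exact: H.
Qed.

(** With w n the sum of the tail of the geometric bound, the intervals
[u n - w n, u n + w n] are nested; the limit is their common point. *)
Lemma geometric_increments_cvg (R : realType) (theta B : R) (u : nat -> R) :
  0 <= theta < 1 -> (forall n, `|u n.+1 - u n| <= B * theta ^+ n) ->
  exists l, forall n, `|u n - l| <= B / (1 - theta) * theta ^+ n.
Proof.
case/andP=> t0 t1 uB; pose w n := B / (1 - theta) * theta ^+ n.
have wS n : w n = w n.+1 + B * theta ^+ n.
  by rewrite /w exprS; field; rewrite subr_eq0 gt_eqF.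
pose a n := u n - w n; pose b n := u n + w n.
have uB' n : - (B * theta ^+ n) <= u n.+1 - u n <= B * theta ^+ n.
  by rewrite -ler_norml.
have aS : nondecreasing_seq a.
  by apply/nondecreasing_seqP => n; have := uB' n; rewrite /a (wS n); lra.
have bS : nonincreasing_seq b.
  by apply/nonincreasing_seqP => n; have := uB' n; rewrite /b (wS n); lra.
have w0 n : 0 <= w n.
  have B0 : 0 <= B by have := le_trans (normr_ge0 _) (uB 0%N); rewrite mulr1.
  by rewrite mulr_ge0 ?exprn_ge0// divr_ge0// subr_ge0 ltW.
have ab n m : a n <= b m.
  apply: le_trans (aS _ _ (leq_maxl n m)) _.
  apply: le_trans _ (bS _ _ (leq_maxr n m)).
  by rewrite /a /b; have := w0 (maxn n m); lra.
have supa : has_sup (range a).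
  by split; [exists (a 0%N), 0%N | exists (b 0%N) => _ [n _ <-]].
exists (sup (range a)) => n.
have h1 : a n <= sup (range a) by apply: ub_le_sup; [exact: supa.2 | exists n].
have h2 : sup (range a) <= b n.
  by apply: ge_sup; [exact: supa.1 | move=> _ [m _ <-]].
by rewrite -/(w n) ler_norml; move: h1 h2; rewrite /a /b; lra.
Qed.

(** * Eigenfunctions of positive operators that contract the cone *)

Section eigenfunction.
Context (R : realType) (X : metricType R) (alpha Delta D D' : R) (x0 : X).
Hypotheses (alpha_gt0 : 0 < alpha).
Hypothesis diamX : forall x y : X, mdist x y `^ alpha <= Delta.
Hypotheses (D'_ge0 : 0 <= D') (D'D : D' < D).
Context (L : (X -> R) -> X -> R).
Hypothesis L_linear : forall s t (f g : X -> R), continuous f -> continuous g ->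
  L (fun y => s * f y + t * g y) = fun x => s * L f x + t * L g x.
Hypothesis L_mono : forall f g : X -> R, continuous f -> continuous g ->
  (forall x, f x <= g x) -> forall x, L f x <= L g x.
Hypothesis L1_gt0 : forall x, 0 < L (cst 1) x.
Hypothesis L_cone : forall h : X -> R,
  log_hoelder_cone alpha D h -> log_hoelder_cone alpha D' (L h).

Let cone_cont (h : X -> R) : log_hoelder_cone alpha D' h -> continuous h.
Proof. exact: log_hoelder_cone_continuous. Qed.

Let cst1_cont : continuous (cst 1 : X -> R).
Proof. by move=> x; exact: cvg_cst. Qed.

Let E := expR (D' * Delta).

Let E_gt0 : 0 < E. Proof. exact: expR_gt0. Qed.

Let harnack (h : X -> R) x y : log_hoelder_cone alpha D' h -> h x <= E * h y.
Proof. exact: log_hoelder_cone_harnack. Qed.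

Let D_ge0 : 0 <= D. Proof. by rewrite (le_trans D'_ge0)// ltW. Qed.

Lemma log_hoelder_cone_gt0 (h : X -> R) x :
  log_hoelder_cone alpha D' h -> 0 < h x0 -> 0 < h x.
Proof.
move=> hD h0; have := lt_le_trans h0 (harnack x0 x hD).
by rewrite pmulr_rgt0.
Qed.

Lemma L_gt0 (h : X -> R) x : log_hoelder_cone alpha D' h -> 0 < h x0 -> 0 < L h x.
Proof.
move=> hD h0; pose m := h x0 / E.
have m0 : 0 < m by rewrite divr_gt0.
have mh y : m * cst 1 y + 0 * cst 1 y <= h y.
  by rewrite mul0r addr0 mulr1 ler_pdivrMr// mulrC; exact: harnack.
have hc := cone_cont hD.
have mc : continuous (fun y : X => m * cst 1 y + 0 * cst 1 y : R).
  by move=> y; exact: cvg_cst.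
apply: lt_le_trans (L_mono mc hc mh x).
by rewrite L_linear// mul0r addr0 mulr_gt0.
Qed.

(** Positivity gives continuity for the sup norm: f <= g + w implies
L f <= L g + w (L 1). *)
Lemma L_sup_norm (f g : X -> R) w x : continuous f -> continuous g ->
  (forall y, `|f y - g y| <= w) -> `|L f x - L g x| <= w * L (cst 1) x.
Proof.
move=> fc gc fg.
have main f1 g1 : continuous f1 -> continuous g1 ->
    (forall y, `|f1 y - g1 y| <= w) -> L f1 x - L g1 x <= w * L (cst 1) x.
  move=> f1c g1c fg1; rewrite lerBlDl.
  have -> : L g1 x + w * L (cst 1) x = L (fun y => 1 * g1 y + w * cst 1 y) x.
    by rewrite L_linear// mul1r.
  apply: L_mono => //.
    move=> y; apply: cvgD; last exact: cvg_cst.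
    by apply: cvgMr; exact: g1c.
  move=> y; rewrite mul1r mulr1 -lerBlDl.
  exact: le_trans (ler_norm _) (fg1 y).
rewrite ler_norml main// andbT lerNl opprB; apply: main => // y.
by rewrite distrC.
Qed.

Let g n := iter n L (cst 1).

Let g_cone n : log_hoelder_cone alpha D' (g n).
Proof.
elim: n => [|n ih]; first exact: log_hoelder_cone1.
by apply: L_cone; apply: log_hoelder_coneS ih; exact: ltW.
Qed.

Let g_gt0 n x : 0 < g n x.
Proof.
elim: n x => [x|n ih x]; first exact: ltr01.
exact: L_gt0.
Qed.

Let g_cont n : continuous (g n). Proof. exact: cone_cont. Qed.

(** The heart of the contraction. In the order defined by K_D, consecutive
iterates g n and g n.+1 satisfy a (g n) <= g n.+1 <= b (g n). Applying L puts
both differences h1 and h2 into the smaller cone, from which t1 (resp. t2)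
times g n.+1 can be taken off without leaving K_D. As
h1 + h2 = (b - a) g n.+1, the new interval [a + t1, b - t2] has length
exactly (1 - c) (b - a), so theta = 1 - c. The bound a0 <= a keeps the ratios
away from 0. *)
Lemma iterates_comparable : exists a0 kappa theta : R,
  [/\ 0 < a0, 0 <= theta < 1 & forall n, exists2 a, a0 <= a &
    log_hoelder_cone alpha D (fun x => g n.+1 x - a * g n x) /\
    log_hoelder_cone alpha D
      (fun x => (a + kappa * theta ^+ n) * g n x - g n.+1 x)].
Proof.
have [c /andP[c0 c1] subK] := log_hoelder_cone_sub diamX D'_ge0 D'D.
pose a0 := c * L (cst 1) x0; pose b0 := L (cst 1) x0 / c.
have a00 : 0 < a0 by rewrite mulr_gt0.
have b00 : 0 < b0 by rewrite divr_gt0.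
(* a0 and b0 come from comparing L 1 with 1, in both directions. *)
exists a0, (b0 - a0), (1 - c); split=> //.
  by rewrite subr_ge0 c1 ltrBlDr ltrDl.
elim=> [|n [a a0a [ha hb]]].
  exists a0 => //; rewrite expr0 mulr1 addrC subrK; split.
    by apply: (subK _ _ x0) (g_cone 1) (g_cone 0) (ltW a00) _; rewrite mulr1.
  have := subK _ _ x0 1 (log_hoelder_coneZ (ltW b00) (g_cone 0)) (g_cone 1) ler01.
  have -> : (fun x => b0 * g 0 x - 1 * g 1 x) = (fun x => b0 * g 0 x - g 1 x).
    by apply/funext => x; rewrite mul1r.
  by apply; rewrite mul1r /= mulr1 /b0 mulrC divfK// gt_eqF.
set w := (b0 - a0) * (1 - c) ^+ n in hb.
pose h1 x := g n.+2 x - a * g n.+1 x.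
pose h2 x := (a + w) * g n.+1 x - g n.+2 x.
have h1K : log_hoelder_cone alpha D' h1.
  rewrite (_ : h1 = L (fun x => g n.+1 x - a * g n x)); first exact: L_cone.
  rewrite (_ : (fun x => g n.+1 x - a * g n x) =
               (fun x => 1 * g n.+1 x + (- a) * g n x)); last first.
    by apply/funext => x; rewrite mul1r mulNr.
  by rewrite L_linear//; apply/funext => x; rewrite /h1 mul1r mulNr.
have h2K : log_hoelder_cone alpha D' h2.
  rewrite (_ : h2 = L (fun x => (a + w) * g n x - g n.+1 x)).
    exact: L_cone.
  rewrite (_ : (fun x => (a + w) * g n x - g n.+1 x) =
               (fun x => (a + w) * g n x + (- 1) * g n.+1 x)); last first.
    by apply/funext => x; rewrite mulN1r.
  by rewrite L_linear//; apply/funext => x; rewrite /h2 mulN1r.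
pose t1 := c * h1 x0 / g n.+1 x0; pose t2 := c * h2 x0 / g n.+1 x0.
have t10 : 0 <= t1 by rewrite divr_ge0 ?mulr_ge0 ?(ltW c0)//; [exact: h1K.1 | exact: ltW].
have t20 : 0 <= t2 by rewrite divr_ge0 ?mulr_ge0 ?(ltW c0)//; [exact: h2K.1 | exact: ltW].
have gn0 : g n.+1 x0 != 0 by rewrite gt_eqF.
have t12 : t1 + t2 = c * w by rewrite /t1 /t2 /h1 /h2; field.
exists (a + t1); first by rewrite ler_wpDr.
split.
  have := subK h1 _ x0 t1 h1K (g_cone n.+1) t10.
  rewrite /t1 divfK// => /(_ (lexx _)); rewrite -/t1.
  congr (log_hoelder_cone _ _ _); apply/funext => x; rewrite /h1; ring.
have := subK h2 _ x0 t2 h2K (g_cone n.+1) t20.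
rewrite {1}/t2 divfK// => /(_ (lexx _)).
congr (log_hoelder_cone _ _ _); apply/funext => x.
have -> : a + t1 + (b0 - a0) * (1 - c) ^+ n.+1 = a + w - t2.
  by rewrite exprS mulrCA -/w mulrBl mul1r -t12; ring.
by rewrite /h2; ring.
Qed.

(** The normalisation at x0 makes the eigenvalue appear by itself: L maps the
n-th normalised iterate to L (psi_ n) x0 times the next one, and L (psi_ n) x0
converges to L psi x0 because psi_ n converges uniformly. *)
Theorem positive_operator_eigenfunction : exists (psi : X -> R) (lambda : R),
  [/\ log_hoelder_cone alpha D' psi, forall x, 0 < psi x, 0 < lambda &
      forall x, L psi x = lambda * psi x].
Proof.
have [a0 [kappa [theta [a00 theta01 sandwich]]]] := iterates_comparable.
have [theta0 theta1] := andP theta01.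
pose psi_ n x := g n x / g n x0.
have psi_1 n : psi_ n x0 = 1 by rewrite /psi_ divff// gt_eqF.
have psi_cone n : log_hoelder_cone alpha D' (psi_ n).
  rewrite /psi_ (_ : (fun _ => _) = (fun x => (g n x0)^-1 * g n x)).
    by apply: log_hoelder_coneZ => //; rewrite invr_ge0 ltW.
  by apply/funext => x; rewrite mulrC.
have psi_le n x : psi_ n x <= E.
  by rewrite -[leRHS]mulr1 -(psi_1 n); exact: harnack.
pose B := E * kappa / a0.
(* P, P0 and Q, Q0 are the values of two consecutive iterates at x and x0; the
   ratios Q / P and Q0 / P0 both lie in [a, a + w], with a >= a0. *)
have psi_incr n x : `|psi_ n.+1 x - psi_ n x| <= B * theta ^+ n.
  have [a a0a [[h1 _] [h2 _]]] := sandwich n.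
  have := h1 x; have := h1 x0; have := h2 x; have := h2 x0.
  set w := kappa * theta ^+ n.
  have := psi_le n x; rewrite /psi_.
  have := g_gt0 n x; have := g_gt0 n x0; have := g_gt0 n.+1 x0.
  move: (g n x) (g n.+1 x) (g n x0) (g n.+1 x0) => P Q P0 Q0.
  move=> Q00 P00 P_gt0 PE h2x0 h2x h1x0 h1x.
  have w0 : 0 <= w.
    have : 0 <= w * P0 by lra.
    by rewrite pmulr_lge0.
  have num : `|Q * P0 - P * Q0| <= w * (P * P0).
    by rewrite ler_norml; apply/andP; split; nra.
  have -> : Q / Q0 - P / P0 = (Q * P0 - P * Q0) / (Q0 * P0).
    by field; rewrite !gt_eqF.
  have -> : B * theta ^+ n = w * E / a0 by rewrite /B /w; ring.
  rewrite normrM normfV (gtr0_norm (mulr_gt0 _ _))//.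
  rewrite ler_pdivrMr ?mulr_gt0//; apply: le_trans num _.
  have PE' : P <= E * P0 by rewrite -ler_pdivrMr.
  have Q0' : a0 * P0 <= Q0.
    by apply: (@le_trans _ _ (a * P0)); [rewrite ler_pM2r | lra].
  rewrite (_ : _ / a0 * _ = w * (E * (Q0 / a0) * P0)); last by ring.
  rewrite ler_wpM2l// ler_pM2r//; apply: le_trans PE' _.
  by rewrite ler_pM2l// ler_pdivlMr// mulrC.
have /choice[psi psiP] x :
    exists l, forall n, `|psi_ n x - l| <= B / (1 - theta) * theta ^+ n.
  exact: geometric_increments_cvg.
pose W := B / (1 - theta).
have psiP1 n x : psi_ n x <= psi x + W * theta ^+ n.
  by have := psiP x n; rewrite ler_norml -/W; lra.
have psiP2 n x : psi x <= psi_ n x + W * theta ^+ n.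
  by have := psiP x n; rewrite ler_norml -/W; lra.
have psiK : log_hoelder_cone alpha D' psi.
  split=> [x|x y].
    apply: (le_geometric theta01) => n; apply: le_trans (psiP1 n x).
    exact: (psi_cone n).1.
  set e := expR _; apply: (@le_geometric _ _ (e * W + W) _ _ theta01) => n.
  apply: le_trans (psiP2 n x) _.
  have := (psi_cone n).2 x y; rewrite -/e => h1.
  have := ler_wpM2l (expR_ge0 _ : 0 <= e) (psiP1 n y); lra.
have psi1 : psi x0 = 1.
  apply/eqP; rewrite eq_le; apply/andP; split; apply: (le_geometric theta01) => n.
    by rewrite -(psi_1 n); exact: psiP2.
  by rewrite -(psi_1 n); exact: psiP1.
have psi_gt0 x : 0 < psi x by apply: log_hoelder_cone_gt0; rewrite ?psi1.
have psi_L n x : L (psi_ n) x = L (psi_ n) x0 * psi_ n.+1 x.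
  have Lpsi y : L (psi_ n) y = g n.+1 y / g n x0.
    rewrite /psi_ (_ : (fun _ => _) = (fun x => (g n x0)^-1 * g n x + 0 * g n x)).
      by rewrite L_linear// mul0r addr0 mulrC.
    by apply/funext => z; rewrite mul0r addr0 mulrC.
  by rewrite !Lpsi /psi_; field; rewrite !gt_eqF.
have Lpsi n x : `|L (psi_ n) x - L psi x| <= W * theta ^+ n * L (cst 1) x.
  by apply: L_sup_norm => [| |y]; [exact: cone_cont..|exact: psiP].
exists psi, (L psi x0); split=> //; first by rewrite L_gt0// psi1.
move=> x; apply/eqP; rewrite -subr_eq0 -normr_le0.
pose C := W * L (cst 1) x + W * L (cst 1) x0 * E + L psi x0 * W.
apply: (@le_geometric _ theta C _ _ theta01) => n; rewrite add0r.
have l0 : 0 < L psi x0 by rewrite L_gt0// psi1.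
(* The three errors: psi_ n for psi inside L, the eigenvalue, psi_ n.+1 for psi. *)
have -> : L psi x - L psi x0 * psi x = - (L (psi_ n) x - L psi x)
    + (L (psi_ n) x0 - L psi x0) * psi_ n.+1 x
    + L psi x0 * (psi_ n.+1 x - psi x).
  by rewrite (psi_L n x); ring.
apply: le_trans (ler_normD _ _) _.
rewrite /C [leRHS]mulrDl [X in _ <= X + _]mulrDl; apply: lerD.
  apply: le_trans (ler_normD _ _) _; apply: lerD.
    by rewrite normrN (le_trans (Lpsi n x))// le_eqVlt; apply/orP; left; apply/eqP; ring.
  rewrite normrM; apply: (@le_trans _ _ ((W * theta ^+ n * L (cst 1) x0) * E)).
    by apply: ler_pM => //; rewrite ger0_norm//; exact: (psi_cone _).1.
  by rewrite le_eqVlt; apply/orP; left; apply/eqP; ring.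
rewrite normrM gtr0_norm// -mulrA ler_pM2l//.
apply: le_trans (psiP x n.+1) _; rewrite -/W exprS mulrCA.
rewrite ler_piMl//; last exact: ltW.
exact: le_trans (normr_ge0 _) (psiP x n).
Qed.

End eigenfunction.

(** * The space of configurations *)

Lemma nbhs_prod_topology (T : topologicalType) (P := prod_topology (fun=> T))
    (x : P) (U : nat -> set T) N : (forall n, nbhs (x n) (U n)) ->
  nbhs x [set y : P | forall n, (n < N)%N -> U n (y n)].
Proof.
move=> xU; elim: N => [|N ih]; first exact: filterE.
have hN : nbhs x [set y : P | U N (y N)].
  exact: (@proj_continuous nat (fun=> T) N x _ (xU N)).
apply: filterS2 hN ih => y yN yn n; rewrite ltnS leq_eqVlt => /orP[/eqP ->//|].
exact: yn.
Qed.

Lemma compact_prod_topology (T : topologicalType) :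
  compact [set: T] -> compact [set: prod_topology (fun _ : nat => T)].
Proof.
move=> cT; have := @tychonoff nat (fun=> T) (fun=> setT) (fun=> cT).
by congr compact; apply/seteqP; split.
Qed.

Section config_space.
Context (R : realType) (M : compactMetricType R).
Implicit Types (a b : M) (x y : config M).

Lemma config_dist_cvg x y :
  series (fun n => 2^-1 ^+ n.+1 * mdist (x n) (y n) : R) n @[n --> \oo]
    --> mdist x y.
Proof. by rewrite config_mdistE; exact: config_dist_is_cvg. Qed.

Lemma mdist_cons a b x y :
  mdist (config_cons a x) (config_cons b y) = (mdist a b + mdist x y) / 2.
Proof.
have := @config_dist_cvg (config_cons a x) (config_cons b y).
rewrite -cvg_shiftS => /cvg_lim <-//; apply: cvg_lim => //.
have h : (mdist a b + series (fun n => 2^-1 ^+ n.+1 * mdist (x n) (y n)) n) / 2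
    @[n --> \oo] --> (mdist a b + mdist x y) / 2.
  apply: cvgMl; apply: cvgD; first exact: cvg_cst.
  exact: config_dist_cvg.
apply: cvg_trans h; apply: near_eq_cvg; apply: nearW => n.
rewrite /series/= big_nat_recl//= expr1 mulrDl [2^-1 * _]mulrC; congr (_ + _).
by rewrite big_distrl/=; apply: eq_bigr => i _; rewrite [in RHS]exprS; ring.
Qed.

Lemma config_diam (K : R) : (forall a b, mdist a b <= K) ->
  forall x y, mdist x y <= K.
Proof.
move=> Kb x y; have cv := @config_dist_cvg x y.
rewrite -(cvg_lim _ cv)//; apply: limr_le; first by apply/cvg_ex; exists (mdist x y).
have K0 : 0 <= K by apply: le_trans (Kb point point); exact: mdist_ge0.
apply: nearW => n; apply: (@le_trans _ _ (K * (1 - 2^-1 ^+ n))); last first.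
  by rewrite ler_piMr// lerBlDr lerDl exprn_ge0// invr_ge0.
elim: n => [|n ih]; first by rewrite /series/= big_nil expr0 subrr mulr0.
rewrite /series/= big_nat_recr//=.
have : 2^-1 ^+ n.+1 * mdist (x n) (y n) <= 2^-1 ^+ n.+1 * K.
  by rewrite ler_wpM2l// exprn_ge0// invr_ge0.
move: ih; rewrite /series/= exprS; lra.
Qed.

(** By induction on N: the distance is the mean of the distance of the first
letters and that of the tails, so each letter halves the error, which is at
first the diameter. *)
Lemma config_dist_agree (K e : R) N x y : (forall a b, mdist a b <= K) ->
  0 <= e -> (forall n, (n < N)%N -> mdist (x n) (y n) <= e) ->
  mdist x y <= e + K * 2^-1 ^+ N.
Proof.
move=> Kb e0; elim: N x y => [|N ih] x y xy.
  rewrite expr0 mulr1; apply: le_trans (@config_diam _ Kb x y) _.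
  by rewrite lerDr.
have cons_eta (z : config M) : z = config_cons (z 0%N) (fun n => z n.+1).
  by apply/funext; case.
rewrite (cons_eta x) (cons_eta y) mdist_cons.
have h1 := xy 0%N isT.
have h2 := ih (fun n => x n.+1) (fun n => y n.+1) (fun n => xy n.+1).
by rewrite exprS; lra.
Qed.

Lemma geometric_small (K e : R) : 0 < e -> exists N, K * 2^-1 ^+ N < e.
Proof.
move=> e0; have cv : K * 2^-1 ^+ n @[n --> \oo] --> K * 0.
  by apply: cvgMr; apply: cvg_expr; rewrite ger0_norm ?invr_ge0// invf_lt1// ltr1n.
have : \forall n \near \oo, `|K * 0 - K * 2^-1 ^+ n| < e by move/cvgrPdist_lt : cv; exact.
move=> [N _ /(_ N (leqnn _))]; rewrite /= mulr0 sub0r normrN => h.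
by exists N; apply: le_lt_trans (ler_norm _) h.
Qed.

(** The metric topology is coarser than the product topology, because distances
depend on finitely many coordinates up to a small error; so Tychonoff's theorem
applies. *)
Lemma config_compact : compact [set: config M].
Proof.
have [K Kb] := mdist_bounded M.
pose P : topologicalType := prod_topology (fun _ : nat => M : topologicalType).
have cP : compact [set: P] by apply: compact_prod_topology; exact: compact_setT.
pose id' (x : P) : config M := x.
have id_cont : continuous id'.
  move=> x U /nbhs_ballP[e /= e0 eU].
  have [N NK] := @geometric_small K (e / 2) (divr_gt0 e0 (ltr0Sn R 1)).
  have nearN : nbhs x [set y : P | forall n, (n < N)%N -> ball (x n : M) (e / 2) (y n)].
    apply: (@nbhs_prod_topology M x (fun n => ball (x n : M) (e / 2))) => n.
    apply: nbhsx_ballx; exact: divr_gt0.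
  move: nearN; apply: filterS => y xy; apply: eU; rewrite ballEmdist/=.
  apply: le_lt_trans (@config_dist_agree K (e / 2) N _ _ Kb _ _) _.
  - by rewrite divr_ge0// ltW.
  - by move=> n nN; have := xy n nN; rewrite ballEmdist => /ltW.
  - by rewrite [ltRHS](splitr e) ltrD2l.
rewrite (_ : [set: config M] = id' @` [set: P]).
  apply: continuous_compact => //; exact: continuous_subspaceT.
by apply/seteqP; split=> // x _; exists x.
Qed.

Lemma config_cons_continuous x : continuous (fun a : M => config_cons a x).
Proof.
move=> a U /nbhs_mdistP[e e0 eU]; apply/nbhs_mdistP; exists e => // b ab.
apply: eU; rewrite mdist_cons mdistxx addr0.
by rewrite ltr_pdivrMr//; have := mdist_ge0 a b; lra.
Qed.

(** Uniformity in the first letter, from the compactness of M: each letter has a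
neighbourhood on which the estimate holds for all y close to x. *)
Lemma near_config_cons (F : config M -> R) x e : continuous F -> 0 < e ->
  \forall y \near x, forall a,
    `|F (config_cons a x) - F (config_cons a y)| <= e.
Proof.
move=> Fc e0; have e20 : 0 < e / 2 by rewrite divr_gt0.
have : near_covering [set: M] by apply/compact_near_coveringP; exact: compact_setT.
move=> /(_ _ (nbhs x)
  (fun y a => `|F (config_cons a x) - F (config_cons a y)| <= e)).
move=> cov; have {cov} : \forall y \near x, [set: M] `<=`
    (fun a => `|F (config_cons a x) - F (config_cons a y)| <= e).
  apply: cov => a _.
  have [d d0 dF] := (continuous_mdistP _).1 Fc (config_cons a x) _ e20.
  exists (ball a d, ball x d).
    by split; apply: nbhsx_ballx.
  move=> [b y] [/=]; rewrite !ballEmdist/= => ab xy.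
  rewrite (_ : _ - _ = (F (config_cons a x) - F (config_cons b y)) -
     (F (config_cons a x) - F (config_cons b x))); last by ring.
  apply: le_trans (ler_normB _ _) _; rewrite [leRHS](splitr e).
  have ab0 := mdist_ge0 a b; have xy0 := mdist_ge0 x y.
  by apply: lerD; apply: dF; rewrite mdist_cons ?mdistxx ltr_pdivrMr//; lra.
by apply: filterS => y h a; exact: h.
Qed.

(** * Integration of continuous functions on M *)

Lemma continuous_borel_measurable (F : M -> R) : continuous F ->
  measurable_fun [set: borel M] (F : borel M -> R).
Proof.
move=> Fc; apply: (measurability (@RGenOInfty.G R)).
  exact: RGenOInfty.measurableE.
move=> _ [_ [r ->] <-]; rewrite setTI; apply: sub_sigma_algebra.
apply: (open_comp (f := F)) => //; exact: interval_open.
Qed.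

Lemma continuous_borel_integrable (nu : probability (borel M) R) (F : M -> R) :
  continuous F -> nu.-integrable setT (EFin \o (F : borel M -> R)).
Proof.
move=> Fc; apply: measurable_bounded_integrable => //.
- exact: le_lt_trans (probability_le1 nu measurableT) (ltry 1).
- exact: continuous_borel_measurable.
have : compact (F @` [set: M]).
  apply: continuous_compact; last exact: compact_setT.
  exact: continuous_subspaceT.
move=> /compact_bounded[N [Nr NB]]; exists N; split => // r Nr' a _.
by apply: (NB r) => //; exists a.
Qed.

(** The set where F is nonzero is open and null, hence empty when the support of
the measure is the whole space. *)
Lemma continuous_integral_eq0 (nu : probability (borel M) R) (F : M -> R) :
  measure_support nu = [set: M] -> continuous F -> (forall a, 0 <= F a) ->
  \int[nu]_a F a = 0 -> forall a, F a = 0.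
Proof.
move=> supp Fc F0 intF a; apply/eqP/negPn/negP => Fa.
have intE : (\int[nu]_a `|(F a)%:E| = 0)%E.
  have Fi := continuous_borel_integrable nu Fc.
  rewrite -[RHS](_ : (\int[nu]_a (F a)%:E)%E = _); last first.
    by rewrite -[LHS]fineK ?integrable_fin_num//; congr EFin.
  by apply: eq_integral => b _; rewrite gee0_abs// lee_fin.
have mF : measurable_fun [set: borel M] (EFin \o (F : borel M -> R)).
  by apply/measurable_EFinP; exact: continuous_borel_measurable.
have [+ _] := ae_eq_integral_abs nu measurableT mF.
move=> /(_ intE)[B [mB B0 FB]].
have oU : open (F @^-1` [set r | r != 0]).
  by apply: open_comp => //; exact: open_neq.
have : a \in measure_support nu by rewrite supp inE.
rewrite inE => /(_ _ oU Fa); apply/negP; rewrite -leNgt -B0.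
apply: le_measure; rewrite ?inE//.
  by apply: sub_sigma_algebra.
move=> b /= Fb; apply: FB => /= /(_ I)[] /eqP; exact/negP.
Qed.

(** Replacing the tail of y beyond the N-th coordinate by x gives a zero of h that
agrees with y on the first N coordinates; these zeros converge to y. *)
Lemma cons_closed_zeros (h : config M -> R) x : continuous h -> h x = 0 ->
  (forall y, h y = 0 -> forall a, h (config_cons a y) = 0) ->
  forall y, h y = 0.
Proof.
move=> hc hx hcons y.
have approx N z : exists2 w, h w = 0 & forall n, (n < N)%N -> w n = z n.
  elim: N z => [|N ih] z; first by exists x.
  have [w hw wz] := ih (fun n => z n.+1).
  by exists (config_cons (z 0%N) w); [exact: hcons | case].
apply/eqP; rewrite -normr_le0; apply/ler_addgt0Pl => e e0; rewrite addr0.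
have [d d0 hd] := (continuous_mdistP h).1 hc y e e0.
have [K Kb] := mdist_bounded M; have [N NK] := @geometric_small K d d0.
have [w hw wy] := approx N y.
rewrite -[h y]subr0 -hw; apply: hd; apply: le_lt_trans NK.
rewrite -[leRHS]add0r; apply: config_dist_agree => // n nN.
by rewrite wy// mdistxx.
Qed.

End config_space.

(** * The Ruelle operator *)

Lemma continuous_expR_mul (R : realType) (T : topologicalType) (A f : T -> R) :
  continuous A -> continuous f -> continuous (fun z => expR (A z) * f z).
Proof.
move=> Ac fc z; apply: cvgM; last exact: fc.
exact: cvg_comp (Ac z) (@continuous_expR R (A z)).
Qed.

Lemma continuous_quotient (R : realType) (T : topologicalType) (f g : T -> R) :
  (forall x, g x != 0) -> continuous f -> continuous g ->
  continuous (fun x => f x / g x).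
Proof.
by move=> g0 fc gc x; apply: cvgM; [exact: fc | apply: cvgV; [exact: g0 | exact: gc]].
Qed.

Lemma continuous_lincomb (R : realType) (T : topologicalType) s t (f g : T -> R) :
  continuous f -> continuous g -> continuous (fun x => s * f x + t * g x).
Proof.
by move=> fc gc x; apply: cvgD; apply: cvgMr; [exact: fc | exact: gc].
Qed.

Section ruelle_operator.
Context (R : realType) (M : compactMetricType R) (alpha : R).
Context (nu : probability (borel M) R) (A : config M -> R).
Hypotheses (alpha_gt0 : 0 < alpha) (HA : hoelder_space alpha A).
Implicit Types (f g h : config M -> R) (x y : config M).

Let A_cont : continuous A. Proof. exact: hoelder_continuous HA. Qed.

Let fiber_continuous f x : continuous f ->
  continuous (fun a => expR (A (config_cons a x)) * f (config_cons a x)).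
Proof.
move=> fc a; apply: (@continuous_comp _ _ _ (fun a => config_cons a x)
  (fun z => expR (A z) * f z)); first exact: config_cons_continuous.
exact: continuous_expR_mul.
Qed.

Let fiber_integrable f x : continuous f -> nu.-integrable setT
  (EFin \o (fun a : borel M => expR (A (config_cons a x)) * f (config_cons a x))).
Proof. by move=> fc; apply: continuous_borel_integrable; exact: fiber_continuous. Qed.

Lemma ruelle_continuous f : continuous f -> continuous (ruelle nu A f).
Proof.
move=> fc; apply/continuous_mdistP => x e e0.
have /nbhs_mdistP[d d0 dF] := near_config_cons x (continuous_expR_mul A_cont fc) e0.
exists d => // y /dF xy; rewrite /ruelle -RintegralB//; [|exact: fiber_integrable..].
apply: le_trans (le_normr_Rintegral _ _) _ => //.
  by apply: continuous_borel_integrable => a; apply: cvgB; exact: fiber_continuous.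
apply: (@le_trans _ _ (\int[nu]_(a in [set: borel M]) e)).
  apply: le_Rintegral => //.
    apply: continuous_borel_integrable => a; apply: cvg_norm.
    by apply: cvgB; exact: fiber_continuous.
  by apply: continuous_borel_integrable => a; exact: cvg_cst.
rewrite Rintegral_cst// (_ : fine _ = 1) ?mulr1//.
by rewrite [X in fine X](@probability_setT _ _ _ nu).
Qed.

Lemma ruelle_linear s t f g : continuous f -> continuous g ->
  ruelle nu A (fun z => s * f z + t * g z) =
  fun x => s * ruelle nu A f x + t * ruelle nu A g x.
Proof.
move=> fc gc; apply/funext => x; rewrite /ruelle.
have intZ r h : continuous h -> nu.-integrable setT (EFin \o (fun a : borel M =>
    r * (expR (A (config_cons a x)) * h (config_cons a x)))).
  move=> hc; apply: continuous_borel_integrable => a; apply: cvgMr.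
  exact: fiber_continuous.
rewrite -!RintegralZl//; [|exact: fiber_integrable..].
rewrite -RintegralD//; [|exact: intZ..].
by apply: eq_Rintegral => a _; ring.
Qed.

Lemma ruelle_mono f g : continuous f -> continuous g ->
  (forall x, f x <= g x) -> forall x, ruelle nu A f x <= ruelle nu A g x.
Proof.
move=> fc gc fg x; apply: le_Rintegral => //; [exact: fiber_integrable..|].
by move=> a _; rewrite ler_wpM2l// expR_ge0.
Qed.

Hypothesis supp_nu : measure_support nu = [set: M].

Lemma ruelle_eq0 h x : continuous h -> (forall y, 0 <= h y) ->
  ruelle nu A h x = 0 -> forall a, h (config_cons a x) = 0.
Proof.
move=> hc h0 Lh a.
have := continuous_integral_eq0 supp_nu (fiber_continuous hc) _ Lh.
move=> /(_ (fun _ => mulr_ge0 (expR_ge0 _) (h0 _)) a)/eqP.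
by rewrite mulf_eq0 expR_eq0 => /eqP.
Qed.

Lemma ruelle1_gt0 x : 0 < ruelle nu A (cst 1) x.
Proof.
rewrite lt_neqAle Rintegral_ge0 ?andbT; last first.
  by move=> a _; rewrite mulr1 expR_ge0.
rewrite eq_sym; apply/negP => /eqP L0.
have cst_cont : continuous (cst 1 : config M -> R).
  by apply/continuous_mdistP => y e e0; exists 1 => // z _; rewrite subrr normr0 ltW.
by have /eqP := ruelle_eq0 cst_cont (fun _ => ler01) L0 point; rewrite oner_eq0.
Qed.

(** Both points ax and ay share their first letter, so their distance is half of
d(x,y): the weight e^A contributes the constant C, h contributes D, and the
halving multiplies their sum by 2^-alpha. *)
Lemma ruelle_cone (Delta C D : R) h :
  (forall x y : config M, mdist x y `^ alpha <= Delta) -> 0 <= D ->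
  (forall x y, `|A x - A y| <= C * mdist x y `^ alpha) ->
  log_hoelder_cone alpha D h ->
  log_hoelder_cone alpha (2^-1 `^ alpha * (C + D)) (ruelle nu A h).
Proof.
move=> diam D0 AC hD; have hc := log_hoelder_cone_continuous diam alpha_gt0 D0 hD.
split=> [x|x y].
  by apply: Rintegral_ge0 => a _; rewrite mulr_ge0 ?expR_ge0//; exact: hD.1.
rewrite /ruelle -RintegralZl//; last exact: fiber_integrable.
apply: le_Rintegral => //; first exact: fiber_integrable.
  by apply: continuous_borel_integrable => a; apply: cvgMr; exact: fiber_continuous.
move=> a _; set ax := config_cons a x; set ay := config_cons a y.
have half : mdist ax ay `^ alpha = 2^-1 `^ alpha * mdist x y `^ alpha.
  by rewrite mdist_cons mdistxx add0r mulrC powRM ?mdist_ge0// invr_ge0.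
have hA : expR (A ax) <= expR (C * mdist ax ay `^ alpha) * expR (A ay).
  by rewrite -expRD ler_expR -lerBlDr (le_trans (ler_norm _))// AC.
apply: le_trans (ler_pM (expR_ge0 (A ax)) (hD.1 ax) hA (hD.2 ax ay)) _.
rewrite [leLHS]mulrACA -[X in X * _]expRD half.
rewrite (_ : C * _ + D * _ = 2^-1 `^ alpha * (C + D) * mdist x y `^ alpha) //; ring.
Qed.

(** The maximum principle: c = max (phi / psi) makes c psi - phi a nonnegative
eigenfunction that vanishes somewhere, hence everywhere. *)
Lemma ruelle_eigenvalue_simple (psi phi : config M -> R) lambda :
  continuous psi -> (forall x, 0 < psi x) -> continuous phi ->
  (forall x, ruelle nu A psi x = lambda * psi x) ->
  (forall x, ruelle nu A phi x = lambda * phi x) ->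
  exists c, forall x, phi x = c * psi x.
Proof.
move=> psic psi0 phic Lpsi Lphi.
have quot_cont : continuous (fun x => phi x / psi x).
  by apply: continuous_quotient => // x; rewrite gt_eqF.
have [z _ zmax] : exists2 z, z \in [set: config M] &
    forall y, y \in [set: config M] -> phi y / psi y <= phi z / psi z.
  apply: compact_EVT_max; [by exists point | exact: config_compact |].
  exact: continuous_subspaceT.
pose c := phi z / psi z; exists c.
pose h x := c * psi x + (-1) * phi x.
have hc : continuous h by exact: continuous_lincomb.
have h0 x : 0 <= h x.
  by rewrite /h mulN1r subr_ge0 -ler_pdivrMr// zmax// inE.
suff hE x : h x = 0 by move=> x; apply/esym/eqP; rewrite -subr_eq0 -mulN1r -/(h x) hE.
apply: (@cons_closed_zeros _ _ h z) => // [|y hy].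
  by rewrite /h /c divfK ?gt_eqF// mulN1r subrr.
apply: ruelle_eq0 => //; rewrite /h ruelle_linear// Lpsi Lphi.
by rewrite mulrCA (mulrCA (-1)) -mulrDr -/(h y) hy mulr0.
Qed.

End ruelle_operator.

(** * Existence and simplicity *)

Theorem theorem1 (R : realType) (M : compactMetricType R) (alpha : R)
    (alpha_gt0 : 0 < alpha) (alpha_le1 : alpha <= 1)
    (nu : probability (borel M) R) (supp_nu : measure_support nu = [set: M])
    (A : config M -> R) (HA : hoelder_space alpha A) :
  (forall phi : config M -> R, continuous phi -> continuous (ruelle nu A phi)) /\
  exists (psi : config M -> R) (lambda : R),
    [/\ hoelder_space alpha psi,
        forall x, 0 < psi x,
        0 < lambda,
        forall x, ruelle nu A psi x = lambda * psi x &
        forall phi : config M -> R, continuous phi ->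
          (forall x, ruelle nu A phi x = lambda * phi x) ->
          exists c : R, forall x, phi x = c * psi x].
Proof.
split; first exact (@ruelle_continuous R M alpha nu A alpha_gt0 HA).
have [K Kb] := mdist_bounded M.
have diam (x y : config M) : mdist x y `^ alpha <= K `^ alpha.
  have xyK : mdist x y <= K by exact: config_diam.
  have K0 : 0 <= K by exact: le_trans (mdist_ge0 x y) xyK.
  by rewrite ge0_ler_powR ?nnegrE ?mdist_ge0// ltW.
have [C [C0 AC]] : exists C : R, 0 < C /\
    forall x y, `|A x - A y| <= C * mdist x y `^ alpha.
  have [C AC] := HA; exists (`|C| + 1); split; first by rewrite ltr_wpDl.
  move=> x y; apply: le_trans (AC x y) _; rewrite ler_wpM2r ?powR_ge0//.
  by rewrite (le_trans (ler_norm C))// lerDl.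
pose q : R := 2^-1 `^ alpha.
have q0 : 0 <= q by exact: powR_ge0.
have q1 : q < 1.
  have : q < 1 `^ alpha; last by rewrite powR1.
  by apply: gt0_ltr_powR; rewrite ?nnegrE ?invr_ge0// invf_lt1// ltr1n.
(* Then q (C + D) < D amounts to q C < C. *)
pose D := C / (1 - q).
have D0 : 0 <= D by rewrite divr_ge0 ?subr_ge0// ltW.
have D'0 : 0 <= q * (C + D) by rewrite mulr_ge0// addr_ge0// ltW.
have D'D : q * (C + D) < D.
  have CE : C = D * (1 - q) by rewrite divfK// gt_eqF// subr_gt0.
  have : 0 < C * (1 - q) by rewrite mulr_gt0// subr_gt0.
  by move: CE; set d := D => ->; lra.
have [psi [lambda [psiK psi0 lambda0 Lpsi]]] := positive_operator_eigenfunction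
  ((fun=> point) : config M) alpha_gt0 diam D'0 D'D (@ruelle_linear R M alpha nu A alpha_gt0 HA)
  (@ruelle_mono R M alpha nu A alpha_gt0 HA) (ruelle1_gt0 alpha_gt0 HA supp_nu)
  (fun h => @ruelle_cone R M alpha nu A alpha_gt0 HA _ C D h diam D0 AC).
exists psi, lambda; split=> //.
  exact: (log_hoelder_cone_hoelder diam D'0 psiK).
move=> phi phic Lphi.
have psic := log_hoelder_cone_continuous diam alpha_gt0 D'0 psiK.
exact: (ruelle_eigenvalue_simple alpha_gt0 HA supp_nu psic psi0 phic Lpsi Lphi).
Qed.
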